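(* Consider the sojourn-time pricing model described in the context with $C\ge1$ servers. Let $\pi^*_s$ be an optimal dynamic policy for the objective $\mathcal{Z}_s$, with rates $\lambda^*_{s,i}$, and let $\tilde\lambda_s=\sum_{i\ge0}\lambda^*_{s,i}\mathbb{P}_i(\pi^*_s)$ be its average arrival rate. Then for every integer $\gamma\ge C-1$ the static policy $\pi^{\tilde\lambda_s,\gamma}$ simultaneously satisfies \[ \mathcal{R}(\pi^{\tilde\lambda_s,\gamma})\ \ge\ \left(1-\frac{\frac{C^C}{C!}}{\sum_{l=0}^{C}\frac{1}{l!}C^l+\frac{1}{C!}C^C(\gamma+1-C)}\right)\mathcal{R}(\pi^*_s) \] and \[ E[W(\pi^{\tilde\lambda_s,\gamma})]\ \le\ \frac{\sum_{i=1}^{C}\frac{1}{(i-1)!}C^i+\frac{1}{C!}C^C\sum_{i=C+1}^{\gamma+1} i}{\sum_{l=0}^{C}\frac{1}{l!}C^{l+1}+\frac{\gamma-C}{C!}C^{C+1}}\;E[W(\pi^*_s)]. \]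
   Context: Model: a service system with $C\ge 1$ identical parallel servers and one first-come-first-served queue of unlimited size. Potential customers arrive according to a Poisson process of rate $\Lambda>0$; each has a valuation drawn i.i.d. from a regular (in Myerson's sense) distribution $F$. A customer offered price $p$ joins iff their valuation is at least $p$, so the effective arrival rate is $\lambda(p)=\Lambda(1-F(p))$; this map is assumed to be a bijection between prices and rates, with inverse $p(\lambda)$, and $\lambda\mapsto\lambda p(\lambda)$ is concave. Service times are i.i.d. exponential with rate $\mu>0$, independent of valuations. A policy $\pi$ is a sequence $(\lambda_0,\lambda_1,\dots)$ with $\lambda_i\in[0,\Lambda]$: with $i$ customers present the price $p(\lambda_i)$ is posted. The number in system is a birth–death process with birth rate $\lambda_i$ and death rate $\mu\min(i,C)$ in state $i$; when stable its stationary probabilities are $\mathbb{P}_i(\pi)=\prod_{k=0}^{i-1}\frac{\lambda_k}{\mu\min(k+1,C)}\big/\big(1+\sum_{n\ge0}\prod_{k=0}^{n}\frac{\lambda_k}{\mu\min(k+1,C)}\big)$. The revenue rate is $\mathcal{R}(\pi)=\sum_{i}\lambda_i p(\lambda_i)\mathbb{P}_i(\pi)$. $W(\pi)$ denotes the steady-state sojourn time (waiting plus service time) of a customer who joins the system under $\pi$; by Little's law $E[W(\pi)]=\sum_i i\,\mathbb{P}_i(\pi)\big/\sum_i\lambda_i\mathbb{P}_i(\pi)$. The sojourn-time objective is $\mathcal{Z}_s(\pi)=\mathcal{R}(\pi)-E[W(\pi)]$ (with $E[W]=+\infty$ for unstable policies), and $\pi^*_s$ maximizes $\mathcal{Z}_s$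 over all policies. For a rate $\lambda$ and integer $\gamma\ge0$, the static (cutoff) policy $\pi^{\lambda,\gamma}$ uses arrival rate $\lambda$ in states $0,1,\dots,\gamma$ and arrival rate $0$ in all states $\ge\gamma+1$. *)

(* Defs.v *)
From HB Require Import structures.
From mathcomp Require Import all_boot all_order all_algebra.
From mathcomp Require Import all_classical all_reals all_analysis.
Set Implicit Arguments.
Unset Strict Implicit.
Unset Printing Implicit Defensive.
Import Order.TTheory GRing.Theory Num.Theory.
Import numFieldNormedType.Exports.
Local Open Scope classical_set_scope.
Local Open Scope ring_scope.

Section Market.
Context {R : realType}.
Implicit Types (F f p : R -> R) (Lam : R).

(* [F], a cumulative distribution function, has density [f]. *)
Definition has_density F f :=
  [/\ measurable_fun setT f,
      forall v, 0 <= f v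
    & forall v, (F v)%:E = (\int[lebesgue_measure]_(t in `]-oo, v]) (f t)%:E)%E].

Definition virtual_value F f (v : R) : R := v - (1 - F v) / f v.

(* Myerson regularity: a positive density and a nondecreasing virtual value on
   the interior of the support. *)
Definition regular F :=
  exists f, has_density F f /\
    let S := [set v | 0 < F v < 1] in
    {in S, forall v, 0 < f v} /\
    {in S &, {homo virtual_value F f : v w / v <= w}}.

Definition demand Lam F (price : R) : R := Lam * (1 - F price).

(* [p] is the inverse of the demand map, a bijection from the set [prices] onto
   the rates.  The rate 0 is left out because the price that generates it is
   infinite when valuations are unbounded; its value is immaterial, since [p] is
   used only through [l * p l]. *)
Definition inverse_demand Lam F (prices : set R) p :=
  set_bij prices `]0, Lam] (demand Lam F) /\
  {in `]0, Lam], forall l, prices (p l) /\ demand Lam F (p l) = l}.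

Definition concave_on (D : set R) (g : R -> R) :=
  convex_function (E := R^o) D (fun x => - g x).

End Market.

Section Queue.
Context {R : realType}.
Variables (C : nat) (mu : R).

Definition policy := nat -> R.
Implicit Types pol : policy.

Definition death_rate (i : nat) : R := mu * (minn i C)%:R.

(* Unnormalized stationary measure of the state [n]. *)
Definition weight pol (n : nat) : R :=
  \prod_(k < n) (pol k / death_rate k.+1).

Definition partition_function pol : \bar R :=
  (1 + \sum_(0 <= n <oo) (weight pol n.+1)%:E)%E.

Definition stable pol : bool := (partition_function pol < +oo)%E.

(* Vanishes identically for unstable policies, as [fine +oo = 0]. *)
Definition stationary pol (i : nat) : R :=
  weight pol i / fine (partition_function pol).

Definition avg_rate pol : R := limn (series (fun i => pol i * stationary pol i)).

Definition mean_number pol : \bar R :=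
  (\sum_(0 <= i <oo) (i%:R * stationary pol i)%:E)%E.

(* Mean steady-state sojourn time, by Little's law. *)
Definition mean_sojourn pol : \bar R :=
  if stable pol then (mean_number pol * ((avg_rate pol)^-1)%:E)%E else +oo%E.

Definition static (l : R) (gamma : nat) : policy :=
  fun i => if (i <= gamma)%N then l else 0.

Section Objective.
Variables (Lam : R) (p : R -> R).

(* The series converges for every policy with rates in [0, Lam], since
   [l * p l] is concave, hence bounded, there. *)
Definition revenue pol : R :=
  limn (series (fun i => pol i * p (pol i) * stationary pol i)).

Definition sojourn_objective pol : \bar R :=
  ((revenue pol)%:E - mean_sojourn pol)%E.

(* When [pol 0 = 0] the stationary law is concentrated on the empty state and no
   customer ever joins, so that the mean sojourn time is 0/0: such policies are
   left out. *)
Definition admissible pol :=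
  (forall i, 0 <= pol i <= Lam) /\ 0 < pol 0%N.

Definition optimal pol :=
  admissible pol /\
  forall pol', admissible pol' ->
    (sojourn_objective pol' <= sojourn_objective pol)%E.

End Objective.
End Queue.

(* Main.v *)
(** By detailed balance the optimal average rate [a] is at most [mu * C], and
    Jensen's inequality for the concave map [l * p l] bounds the optimal revenue
    by [a * p a].  The static policy earns [a * p a] times its admission
    probability, and its mean sojourn time is the mean of
    [(i + 1) / (mu * min (i + 1) C)], nondecreasing in [i], over the states [i]
    that admit customers.  As the stationary weights at load [a] are those at the
    critical load [mu * C] tilted by [(a / (mu * C)) ^ i], Chebyshev's sum
    inequality reduces both claims to the critical load, where they are the
    displayed constants; no policy has a mean sojourn time below [1 / mu].
    Prices may be negative, so the first claim also needs the optimal revenue to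
    be nonnegative: otherwise admitting customers at a vanishing rate, and only
    to the empty system, would do better. *)
Require Import Defs.
From HB Require Import structures.
From mathcomp Require Import all_boot all_order all_algebra.
From mathcomp Require Import all_classical all_reals all_analysis.
From mathcomp Require Import ring lra.
Import Order.TTheory GRing.Theory Num.Theory.
Import numFieldNormedType.Exports.
Local Open Scope classical_set_scope.
Local Open Scope ring_scope.

(** * Critical-load weights and the tilting inequality *)

Section Erlang.
Context {R : realType}.

(* Stationary weights of the M/M/C queue at the critical load [l = mu * C]. *)
Definition erlang (C i : nat) : R := \prod_(k < i) (C%:R / (minn k.+1 C)%:R).

Lemma erlangS C i : erlang C i.+1 = erlang C i * (C%:R / (minn i.+1 C)%:R).
Proof. by rewrite /erlang big_ord_recr. Qed.

Lemma natr_minn_gt0 C i : (0 < C)%N -> 0 < (minn i.+1 C)%:R :> R.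
Proof. by move=> C0; rewrite ltr0n leq_min /= C0. Qed.

Lemma erlang_gt0 C i : (0 < C)%N -> 0 < erlang C i.
Proof.
move=> C0; apply: prodr_gt0 => k _.
by rewrite divr_gt0 ?natr_minn_gt0// ltr0n.
Qed.

Lemma erlang_le C i : (i <= C)%N -> erlang C i = C%:R ^+ i / i`!%:R.
Proof.
elim: i => [|i IH] iC; first by rewrite /erlang big_ord0 expr0 fact0 divr1.
rewrite erlangS IH ?(ltnW iC)// (minn_idPl iC) exprSr factS natrM.
by rewrite mulf_div [_`!%:R * _]mulrC.
Qed.

Lemma erlang_ge C i : (0 < C)%N -> (C <= i)%N -> erlang C i = C%:R ^+ C / C`!%:R.
Proof.
move=> C0; elim: i => [|i IH]; first by rewrite leqNgt C0.
rewrite leq_eqVlt => /predU1P[<-|Ci]; first exact: erlang_le.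
by rewrite erlangS IH// (minn_idPr (ltnW Ci)) divff ?mulr1// pnatr_eq0 -lt0n.
Qed.

(** From index [C] on the weights are constant, so the sum grows linearly in [n - C]. *)
Lemma sum_erlang C n : (0 < C)%N -> (C <= n)%N ->
  \sum_(i < n.+1) erlang C i =
  \sum_(0 <= l < C.+1) C%:R ^+ l / l`!%:R
  + C%:R ^+ C / C`!%:R * (n%:R - C%:R).
Proof.
move=> C0 Cn; rewrite -(subnK Cn) addnC natrD addrAC subrr add0r.
elim: (n - C)%N => [|m IH].
  rewrite addn0 mulr0 addr0 big_mkord; apply: eq_bigr => i _.
  by rewrite erlang_le// -ltnS.
rewrite addnS big_ord_recr /= IH (erlang_ge C (_ + m).+1)//; last first.
  by rewrite -addnS leq_addr.
by rewrite -addrA -natr1 mulrDr mulr1.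
Qed.

(** Obtained from [sum_erlang] at [gamma.+1] by removing the last term. This covers [gamma = C - 1],
    where [gamma%:R - C%:R] is the real number -1 and [sum_erlang] does not apply at [gamma]
    itself. *)
Lemma sum_erlang_pred C gamma : (0 < C)%N -> (C - 1 <= gamma)%N ->
  C%:R * \sum_(i < gamma.+1) erlang C i =
  \sum_(0 <= l < C.+1) C%:R ^+ l.+1 / l`!%:R
  + (gamma%:R - C%:R) / C`!%:R * C%:R ^+ C.+1.
Proof.
move=> C0; rewrite leq_subLR add1n => Cg.
have := sum_erlang C gamma.+1 C0 Cg.
rewrite big_ord_recr /= (erlang_ge C gamma.+1)//.
move=> /(canRL (addrK _)) ->; rewrite mulrBr mulrDr mulr_sumr -natr1 exprS.
under [in RHS]eq_bigr do rewrite exprS -mulrA.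
by ring.
Qed.

Lemma sum_erlang_weighted C gamma : (0 < C)%N -> (C - 1 <= gamma)%N ->
  C%:R * \sum_(i < gamma.+1) erlang C i * (i.+1%:R / (minn i.+1 C)%:R) =
  \sum_(1 <= i < C.+1) C%:R ^+ i / (i.-1)`!%:R
  + C%:R ^+ C / C`!%:R * \sum_(C.+1 <= i < gamma.+2) i%:R.
Proof.
move=> C0; rewrite leq_subLR add1n => Cg.
(* The factor [C / min (i + 1) C] carries the weight of [i] to that of [i + 1], so the sum becomes
   the first moment over the states 1 to [gamma.+1]. *)
have -> : C%:R * \sum_(i < gamma.+1) erlang C i * (i.+1%:R / (minn i.+1 C)%:R) =
    \sum_(1 <= i < gamma.+2) erlang C i * i%:R.
  rewrite big_add1 /= big_mkord mulr_sumr; apply: eq_bigr => i _.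
  by rewrite erlangS; ring.
rewrite (big_cat_nat (n := C.+1))//=; congr (_ + _).
  rewrite !big_add1 /= !big_nat; apply: eq_bigr => i iC.
  rewrite erlang_le// factS natrM -mulrA invfM mulrAC mulVf ?mul1r//.
rewrite mulr_sumr !big_nat; apply: eq_bigr => i /andP[Ci _].
by rewrite erlang_ge// ltnW.
Qed.

(* Chebyshev's sum inequality for weights tilted by the powers of [t <= 1]. *)
Lemma tilted_mean_le (t : R) (a h : nat -> R) n : 0 <= t <= 1 ->
  (forall i, 0 <= a i) -> {homo h : i j / (i <= j)%N >-> i <= j} ->
  (\sum_(i < n) t ^+ i * a i * h i) * (\sum_(i < n) a i) <=
  (\sum_(i < n) a i * h i) * (\sum_(i < n) t ^+ i * a i).
Proof.
move=> /andP[t0 t1] a0 hh; rewrite -subr_ge0.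
set D := (X in 0 <= X).
(* Symmetrizing the double sum in [i] and [j] makes every term nonnegative: [h] increases while the
   powers of [t] decrease. *)
suff -> : D = 2^-1 * \sum_(i < n) \sum_(j < n)
    a i * a j * ((h i - h j) * (t ^+ j - t ^+ i)).
  rewrite mulr_ge0 ?invr_ge0//; apply: sumr_ge0 => i _; apply: sumr_ge0 => j _.
  apply: mulr_ge0; first exact: mulr_ge0.
  case: (leqP i j) => [ij|/ltnW ij].
    by rewrite mulr_le0// subr_le0 ?hh// ler_wiXn2l.
  by rewrite mulr_ge0// subr_ge0 ?hh// ler_wiXn2l.
have E (u v : 'I_n -> R) : (\sum_(i < n) u i) * (\sum_(i < n) v i) =
    \sum_(i < n) \sum_(j < n) u i * v j.
  by rewrite big_distrl; apply: eq_bigr => i _; rewrite big_distrr.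
have E' (u v : 'I_n -> R) : (\sum_(i < n) u i) * (\sum_(i < n) v i) =
    \sum_(i < n) \sum_(j < n) u j * v i.
  by rewrite E exchange_big.
transitivity (2^-1 * ((D + D))); first by field.
congr (_ * _); rewrite {1}/D E E /D E' E' -!sumrB -big_split /=.
apply: eq_bigr => i _; rewrite -!sumrB -big_split /=; apply: eq_bigr => j _.
ring.
Qed.

(** The ratio is the maximum of 1 and [(i + 1) / C]. *)
Lemma ler_minn_ratio C : (0 < C)%N ->
  {homo (fun i => i.+1%:R / (minn i.+1 C)%:R : R) : i j / (i <= j)%N >-> i <= j}.
Proof.
move=> C0 i j ij; rewrite ler_pdivrMr ?natr_minn_gt0// mulrAC ler_pdivlMr ?natr_minn_gt0//.
rewrite -!natrM ler_nat.
case: (leqP j.+1 C) => jC; first by rewrite (minn_idPl (leq_trans _ jC))// mulnC.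
case: (leqP i.+1 C) => iC; last by rewrite leq_mul2r ltnS ij orbT.
by rewrite mulnC leq_mul2r ltnW ?orbT.
Qed.

End Erlang.

(** * Concave functions on an interval and Jensen's inequality for series *)

Section Concave.
Context {R : realType}.
Variables (L : R) (g : R -> R).
Hypotheses (L0 : 0 < L) (cg : concave_on `[0, L] g).

(** Concavity cleared of denominators, so that the degenerate case [x = y] is included. *)
Lemma concave_chord (x a y : R) : 0 <= x -> x <= a -> a <= y -> y <= L ->
  (y - a) * g x + (a - x) * g y <= (y - x) * g a.
Proof.
move=> x0 xa ay yL.
have [xy|xy] := ltP x y; last first.
  have -> : a = x by apply/eqP; rewrite eq_le xa (le_trans ay).
  have -> : y = x by apply/eqP; rewrite eq_le xy (le_trans xa).
  by rewrite subrr !mul0r addr0.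
have yx0 : 0 < y - x by rewrite subr_gt0.
have t01 : 0 <= (y - a) / (y - x) <= 1.
  by rewrite divr_ge0 ?subr_ge0 ?(ltW xy)//= ler_pdivrMr// mul1r lerB.
have /andP[t0 t1] := t01.
have xin : x \in (`[0, L]%classic : set R).
  by rewrite inE /= in_itv /= x0 (le_trans xa (le_trans ay yL)).
have yin : y \in (`[0, L]%classic : set R).
  by rewrite inE /= in_itv /= yL (le_trans x0 (le_trans xa ay)).
set t := (y - a) / (y - x) in t01 t0 t1.
have : - g (t * x + (1 - t) * y) <= t * - g x + (1 - t) * - g y :=
  cg (Itv01 t0 t1) x y xin yin.
have -> : t * x + (1 - t) * y = a by rewrite /t; field; rewrite gt_eqF.
rewrite !mulrN -opprD lerN2 => /(ler_wpM2l (ltW yx0)).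
congr (_ <= _); rewrite /t; field; by rewrite gt_eqF.
Qed.

(** Every chord from [a] to the right has slope at most that of any chord from the left; [m] is the
    supremum of the right slopes. Both families are nonempty because [a] is interior. *)
Lemma concave_supporting_line (a : R) : 0 < a -> a < L ->
  exists m : R, forall y : R, 0 <= y <= L -> g y <= g a + m * (y - a).
Proof.
move=> a0 aL.
pose S := [set (g y - g a) / (y - a) | y in [set y | a < y <= L]].
have ub x : 0 <= x < a -> ubound S ((g a - g x) / (a - x)).
  move=> /andP[x0 xa] _ [y /= /andP[ay yL] <-].
  have := concave_chord x a y x0 (ltW xa) (ltW ay) yL.
  rewrite ler_pdivrMr ?subr_gt0// mulrAC ler_pdivlMr ?subr_gt0//; nra.
have S0 : S !=set0 by exists ((g L - g a) / (L - a)), L => //=; rewrite aL lexx.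
have hub : has_ubound S by exists ((g a - g 0) / (a - 0)); apply: ub; rewrite lexx.
exists (sup S) => y /andP[y0 yL].
have [ya|ay|<-] := ltgtP y a; last by rewrite subrr mulr0 addr0.
- have : sup S <= (g a - g y) / (a - y) by apply: ge_sup => //; apply: ub; rewrite y0.
  rewrite ler_pdivlMr ?subr_gt0//; nra.
- have : (g y - g a) / (y - a) <= sup S.
    by apply: ub_le_sup => //; exists y => //=; rewrite ay.
  rewrite ler_pdivrMr ?subr_gt0//; nra.
Qed.

(** The supporting line at the midpoint bounds [g] from above, the chord joining the endpoints from
    below. *)
Lemma concave_bounded : exists M : R, forall y : R, 0 <= y <= L -> `|g y| <= M.
Proof.
have Lgt0 := L0; have [h0 hL] : 0 < L / 2 /\ L / 2 < L by split; lra.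
have [m hm] := concave_supporting_line (L / 2) h0 hL.
exists (`|g (L / 2)| + `|m| * L + `|g 0| + `|g L|) => y /andP[y0 yL].
have n0 := normr_ge0 (g 0). have nL := normr_ge0 (g L).
have nh := normr_ge0 (g (L / 2)).
have mL : 0 <= `|m| * L by rewrite mulr_ge0// ltW.
rewrite ler_norml; apply/andP; split; last first.
  have := hm y; rewrite y0 yL => /(_ isT) gy.
  have : m * (y - L / 2) <= `|m| * L.
    apply: (le_trans (ler_norm _)); rewrite normrM ler_wpM2l//.
    by rewrite ler_norml; apply/andP; split; lra.
  have := ler_norm (g (L / 2)); lra.
have := concave_chord 0 y L (lexx _) y0 yL (lexx _); rewrite !subr0.
have g0 : - `|g 0| <= g 0 by rewrite lerNl -normrN ler_norm.
have gL : - `|g L| <= g L by rewrite lerNl -normrN ler_norm.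
have h1 : (L - y) * - (`|g 0| + `|g L|) <= (L - y) * g 0.
  by rewrite ler_wpM2l ?subr_ge0//; lra.
have h2 : y * - (`|g 0| + `|g L|) <= y * g L by rewrite ler_wpM2l//; lra.
move=> h; suff : - (`|g 0| + `|g L|) <= g y by lra.
rewrite -(ler_pM2l Lgt0); lra.
Qed.

Variables (P l : nat -> R) (a : R).
Hypotheses (P0 : forall i, 0 <= P i) (l01 : forall i, 0 <= l i <= L).
Hypotheses (P1 : series P @ \oo --> (1 : R)).
Hypotheses (la : series (fun i => l i * P i) @ \oo --> a) (a0 : 0 < a).

Lemma is_cvg_series_concave : cvgn (series (fun i => g (l i) * P i)).
Proof.
have [M hM] := concave_bounded.
apply: normed_cvg.
apply: (@series_le_cvg _ _ (fun i => M * P i)) => [i|i|i|].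
- exact: normr_ge0.
- by rewrite mulr_ge0//; apply: le_trans (hM _ (l01 i)).
- by rewrite /= normrM (ger0_norm (P0 i)) ler_wpM2r// hM.
- by apply: is_cvg_seriesZ; apply/cvg_ex; exists 1.
Qed.

Lemma mean_rate_le : a <= L.
Proof.
have cP : cvgn (series P) by apply/cvg_ex; exists 1.
have -> : a = limn (series (fun i => l i * P i)) by apply/esym/cvg_lim.
have -> : L = limn (series (fun i => L * P i)).
  by rewrite lim_seriesZ// (cvg_lim _ P1)// /GRing.scale /= mulr1.
apply: lim_series_le; first by apply/cvg_ex; exists a.
  exact: is_cvg_seriesZ.
by move=> i; rewrite ler_wpM2r//; case/andP: (l01 i).
Qed.

(** Average the supporting line at [a] against [P]: its linear part vanishes, since [P] has mass 1
    and the rates have mean [a]. *)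
Lemma jensen_series : limn (series (fun i => g (l i) * P i)) <= g a.
Proof.
have cP : cvgn (series P) by apply/cvg_ex; exists 1.
have cl : cvgn (series (fun i => l i * P i)) by apply/cvg_ex; exists a.
have := mean_rate_le; rewrite le_eqVlt => /predU1P[aL|aL].
  (* all the mass sits at [L], where [g] need not have a supporting line *)
  suff h i : g (l i) * P i = g a * P i.
    under eq_fun do rewrite h.
    by rewrite lim_seriesZ// (cvg_lim _ P1)// /GRing.scale /= mulr1.
  suff : (L - l i) * P i = 0.
    move/eqP; rewrite mulf_eq0 subr_eq0 => /orP[/eqP <-|/eqP ->].
      by rewrite aL.
    by rewrite !mulr0.
  pose u i := (L - l i) * P i.
  have u0 j : 0 <= u j by rewrite mulr_ge0// subr_ge0; case/andP: (l01 j).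
  (* The nonnegative terms [u] sum to [L * 1 - a = 0], so each of them is zero. *)
  have cu : series u @ \oo --> (0 : R).
    have -> : series u = L *: series P - series (fun i => l i * P i).
      apply/funext => n; rewrite /u /series /= -[RHS]/(_ * _ - _) mulr_sumr -sumrB.
      by apply: eq_bigr => j _; rewrite mulrBl.
    have -> : 0 = L * 1 - a :> R by rewrite mulr1 aL subrr.
    apply: cvgB => //; exact: cvgZr.
  apply/eqP; rewrite eq_le u0 andbT.
  have := nondecreasing_cvgn_le (nondecreasing_series (P := xpredT) (fun n _ _ => u0 n)).
  move=> /(_ 0%N (cvgP _ cu) i.+1); rewrite (cvg_lim _ cu)//; apply: le_trans.
  by rewrite /series /= big_nat_recr //= lerDr sumr_ge0.
have [m hm] := concave_supporting_line a a0 aL.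
have -> : g a = limn (series ((g a - m * a) *: P + m *: (fun i => l i * P i) : nat -> R)).
  rewrite lim_seriesD; [|exact: is_cvg_seriesZ..].
  by rewrite !lim_seriesZ// (cvg_lim _ P1)// (cvg_lim _ la)// /GRing.scale /=; ring.
apply: lim_series_le.
- exact: is_cvg_series_concave.
- by apply: is_cvg_seriesD; exact: is_cvg_seriesZ.
- move=> i; rewrite -[leRHS]/((g a - m * a) * P i + m * (l i * P i)).
  by have := ler_wpM2r (P0 i) (hm _ (l01 i)); lra.
Qed.

End Concave.

(** * Series with finitely many nonzero terms *)

Section FiniteSupport.
Context {R : realType}.

Lemma lim_series_finite_support (u : R ^nat) n : (forall i, (n <= i)%N -> u i = 0) ->
  limn (series u) = \sum_(i < n) u i.
Proof.
move=> un; apply: cvg_lim => //; apply: cvg_near_cst; exists n => // m /= nm.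
rewrite /series /= (big_cat_nat (n := n))//= big_mkord.
suff -> : \sum_(n <= i < m) u i = 0 by rewrite addr0.
by rewrite big_nat big1// => i /andP[/un].
Qed.

Lemma eseries_finite_support (u : R ^nat) n : (forall i, (n <= i)%N -> u i = 0) ->
  (\sum_(0 <= i <oo) (u i)%:E = (\sum_(i < n) u i)%:E)%E.
Proof.
move=> un; apply: cvg_lim => //; apply: cvg_near_cst; exists n => // m /= nm.
rewrite sumEFin (big_cat_nat (n := n))//= big_mkord.
suff -> : \sum_(n <= i < m) u i = 0 by rewrite addr0.
by rewrite big_nat big1// => i /andP[/un].
Qed.

End FiniteSupport.

(** * Stationary law, average rate and sojourn time of a stable policy *)

Section BirthDeath.
Context {R : realType}.
Variables (C : nat) (mu : R).
Hypotheses (C0 : (0 < C)%N) (mu0 : 0 < mu).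

Lemma death_rate_gt0 i : 0 < death_rate C mu i.+1.
Proof. by rewrite mulr_gt0// natr_minn_gt0. Qed.

Lemma weightS pol n :
  weight C mu pol n.+1 = weight C mu pol n * (pol n / death_rate C mu n.+1).
Proof. by rewrite /weight big_ord_recr. Qed.

Lemma weight0 pol : weight C mu pol 0 = 1.
Proof. by rewrite /weight big_ord0. Qed.

Section Policy.
Variables (pol : nat -> R) (Lam : R).
Hypothesis pol01 : forall i, 0 <= pol i <= Lam.

Lemma weight_ge0 n : 0 <= weight C mu pol n.
Proof.
elim: n => [|n IH]; first by rewrite weight0.
have /andP[p0 _] := pol01 n.
by rewrite weightS mulr_ge0// divr_ge0// ltW// death_rate_gt0.
Qed.

Lemma partition_functionE :
  partition_function C mu pol = (\sum_(0 <= n <oo) (weight C mu pol n)%:E)%E.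
Proof.
rewrite [RHS]nneseries_recl//; last by move=> k _; rewrite lee_fin weight_ge0.
rewrite weight0 /partition_function; congr (_ + _)%E.
rewrite -(@nneseries_addn _ (fun n => (weight C mu pol n)%:E) 1).
  by apply: eq_eseriesr => i _; rewrite addn1.
by move=> i; rewrite lee_fin weight_ge0.
Qed.

Hypothesis stab : stable C mu pol.
Let Z := fine (partition_function C mu pol).

Lemma partition_function_fin : partition_function C mu pol = Z%:E.
Proof.
rewrite /Z fineK// ge0_fin_numE// partition_functionE.
by apply: nneseries_ge0 => n _ _; rewrite lee_fin weight_ge0.
Qed.

Lemma partition_function_gt0 : 0 < Z.
Proof.
rewrite -lte_fin -partition_function_fin /partition_function.
rewrite (@lt_le_trans _ _ 1%:E) ?lte_fin// leeDl//.
by apply: nneseries_ge0 => n _ _; rewrite lee_fin weight_ge0.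
Qed.

Lemma cvg_series_weight : series (weight C mu pol) @ \oo --> Z.
Proof.
have nd : nondecreasing_seq (series (weight C mu pol)).
  by apply: nondecreasing_series => n _ _; exact: weight_ge0.
have cw : cvgn (series (weight C mu pol)).
  apply: nondecreasing_is_cvgn => //; exists Z => _ [n _ <-].
  rewrite -lee_fin -partition_function_fin partition_functionE /series /= -sumEFin.
  by apply: nneseries_lim_ge => k _; rewrite lee_fin weight_ge0.
suff -> : Z = limn (series (weight C mu pol)) by [].
apply: EFin_inj; rewrite -partition_function_fin partition_functionE -EFin_lim//.
by congr (lim (_ @ \oo)); apply/funext => n /=; rewrite sumEFin.
Qed.

Let P := stationary C mu pol.

Lemma stationary_ge0 i : 0 <= P i.
Proof. by rewrite divr_ge0 ?weight_ge0// ltW// partition_function_gt0. Qed.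

Lemma stationary0_gt0 : 0 < P 0%N.
Proof. by rewrite /P /stationary weight0 divr_gt0// partition_function_gt0. Qed.

Lemma cvg_series_stationary : series P @ \oo --> (1 : R).
Proof.
have -> : series P = (fun n => series (weight C mu pol) n * Z^-1).
  by apply/funext => n; rewrite /series /= mulr_suml.
rewrite -(divff (lt0r_neq0 partition_function_gt0)).
exact: cvgMl cvg_series_weight.
Qed.

(** Detailed balance across the cut between [i] and [i.+1]. *)
Lemma balance i : pol i * P i = mu * (minn i.+1 C)%:R * P i.+1.
Proof.
rewrite /P /stationary weightS /death_rate; field.
by rewrite !gt_eqF ?natr_minn_gt0// partition_function_gt0.
Qed.

Lemma cvg_avg_rate : series (fun i => pol i * P i) @ \oo --> avg_rate C mu pol.
Proof.
apply: (@series_le_cvg _ _ (fun i => Lam * P i)) => [i|i|i|].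
- by case/andP: (pol01 i) => p0 _; rewrite mulr_ge0// stationary_ge0.
- case/andP: (pol01 i) => p0 pL; rewrite mulr_ge0 ?stationary_ge0//.
  exact: le_trans pL.
- by rewrite ler_wpM2r ?stationary_ge0//; case/andP: (pol01 i).
- by apply: is_cvg_seriesZ; apply/cvg_ex; exists 1; exact: cvg_series_stationary.
Qed.

Lemma series_rate_le_avg n : \sum_(i < n) pol i * P i <= avg_rate C mu pol.
Proof.
have nd : nondecreasing_seq (series (fun i => pol i * P i)).
  apply: nondecreasing_series => i _ _.
  by case/andP: (pol01 i) => p0 _; rewrite mulr_ge0// stationary_ge0.
have := nondecreasing_cvgn_le nd (cvgP _ cvg_avg_rate) n.
by rewrite /series /= big_mkord.
Qed.

Lemma avg_rate_gt0 : 0 < pol 0%N -> 0 < avg_rate C mu pol.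
Proof.
move=> p0; apply: lt_le_trans (series_rate_le_avg 1); rewrite big_ord1.
by rewrite mulr_gt0// stationary0_gt0.
Qed.

(** By [balance] the arrival flow is a service flow, with at most [C] busy servers, weighted by the
    probabilities of the nonempty states, whose sum is at most 1. *)
Lemma avg_rate_le_capacity : avg_rate C mu pol <= mu * C%:R.
Proof.
have c1 := cvg_series_stationary; have cP := cvgP _ c1.
apply: limr_le; first exact: (cvgP _ cvg_avg_rate).
apply: nearW => n; rewrite /series /= big_mkord.
apply: (@le_trans _ _ (mu * C%:R * series P n.+1)); last first.
  rewrite -[leRHS]mulr1 ler_wpM2l ?mulr_ge0 ?(ltW mu0)//.
  rewrite -(cvg_lim _ c1)//; apply: nondecreasing_cvgn_le => //.
  by apply: nondecreasing_series => i _ _; exact: stationary_ge0.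
rewrite /series /= big_mkord big_ord_recl mulrDr ler_wpDl//.
  by rewrite mulr_ge0 ?stationary_ge0// mulr_ge0// ltW.
rewrite mulr_sumr ler_sum// => i _; rewrite balance ler_wpM2r ?stationary_ge0//.
by rewrite ler_wpM2l ?(ltW mu0)// ler_nat geq_minr.
Qed.

(** Busy servers number at most the customers present. The comparison is made on partial sums
    because the mean number may be infinite even for a stable policy. *)
Lemma avg_rate_le_mean_number :
  ((avg_rate C mu pol / mu)%:E <= mean_number C mu pol)%E.
Proof.
have nn i : (0 <= (i%:R * P i)%:E)%E by rewrite lee_fin mulr_ge0// stationary_ge0.
have h n : (((\sum_(i < n) pol i * P i) / mu)%:E <= mean_number C mu pol)%E.
  apply: (@le_trans _ _ (\sum_(0 <= i < n.+1) (i%:R * P i)%:E)%E); last first.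
    exact: nneseries_lim_ge.
  rewrite sumEFin lee_fin big_mkord big_ord_recl mul0r add0r mulr_suml.
  apply: ler_sum => i _; rewrite balance.
  rewrite (_ : _ / mu = (minn i.+1 C)%:R * P i.+1); last by field; rewrite gt_eqF.
  by rewrite ler_wpM2r ?stationary_ge0// ler_nat geq_minl.
have [fin|] := boolP (mean_number C mu pol \is a fin_num); last first.
  rewrite ge0_fin_numE ?nneseries_ge0// -leNgt leye_eq => /eqP ->.
  exact: leey.
rewrite -(fineK fin) lee_fin ler_pdivrMr//.
apply: limr_le; first exact: (cvgP _ cvg_avg_rate).
apply: nearW => n; rewrite /series /= big_mkord -ler_pdivrMr//.
by rewrite -lee_fin fineK.
Qed.

Lemma mean_sojourn_ge : 0 < pol 0%N -> ((mu^-1)%:E <= mean_sojourn C mu pol)%E.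
Proof.
move=> /avg_rate_gt0 a0; rewrite /mean_sojourn stab.
rewrite lee_pdivlMr// -EFinM mulrC.
exact: avg_rate_le_mean_number.
Qed.

End Policy.

(** * Closed forms for static policies *)

Section Static.
Variables (l : R) (gamma : nat).
Hypothesis l0 : 0 < l.
Let t := l / (mu * C%:R).
Let S n := \sum_(i < n) t ^+ i * erlang C i.

(** The support includes [gamma.+1]: that state is reached from [gamma], although it admits
    nobody. *)
Lemma weight_static n : weight C mu (static l gamma) n =
  if (n <= gamma.+1)%N then t ^+ n * erlang C n else 0.
Proof.
elim: n => [|n IH]; first by rewrite weight0 expr0 /erlang big_ord0 mul1r.
rewrite weightS IH /static ltnS.
case: (leqP n gamma) => ng; last by rewrite mul0r mulr0.
rewrite (leqW ng) erlangS exprS /t /death_rate; field.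
by rewrite !gt_eqF ?natr_minn_gt0// ltr0n.
Qed.

Lemma static_load_gt0 : 0 < t.
Proof. by rewrite divr_gt0// mulr_gt0// ltr0n. Qed.

Lemma truncated_sum_gt0 n : 0 < S n.+1.
Proof.
rewrite /S big_ord_recl expr0 mul1r ltr_pwDl ?erlang_gt0//.
apply: sumr_ge0 => i _; rewrite mulr_ge0 ?exprn_ge0 ?(ltW static_load_gt0)//.
by rewrite ltW// erlang_gt0.
Qed.

Lemma partition_function_static :
  partition_function C mu (static l gamma) = (S gamma.+2)%:E.
Proof.
rewrite /partition_function (eseries_finite_support _ gamma.+1); last first.
  by move=> i gi; rewrite weight_static ltnS leqNgt gi.
rewrite -EFinD /S [in RHS]big_ord_recl; congr (_ + _)%:E.
  by rewrite expr0 mul1r /erlang big_ord0.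
by apply: eq_bigr => i _; rewrite weight_static ltn_ord.
Qed.

Lemma stable_static : stable C mu (static l gamma).
Proof. by rewrite /stable partition_function_static ltry. Qed.

Lemma stationary_static n : stationary C mu (static l gamma) n =
  if (n <= gamma.+1)%N then t ^+ n * erlang C n / S gamma.+2 else 0.
Proof.
rewrite /stationary weight_static partition_function_static /=.
by case: ifP; rewrite ?mul0r.
Qed.

(** Serves both the revenue and the average rate. Since [f 0 = 0], the blocking state contributes
    nothing, whatever the value of [p 0]. *)
Lemma lim_series_static (f : R -> R) : f 0 = 0 ->
  limn (series (fun i => f (static l gamma i) * stationary C mu (static l gamma) i))
  = f l * (S gamma.+1 / S gamma.+2).
Proof.
move=> f0; rewrite (lim_series_finite_support _ gamma.+1); last first.
  by move=> i gi; rewrite /static leqNgt gi /= f0 mul0r.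
rewrite mulr_suml mulr_sumr; apply: eq_bigr => i _; have ig := leq_ord i.
by rewrite stationary_static /static ig (leqW ig).
Qed.

Lemma revenue_static p :
  revenue C mu p (static l gamma) = l * p l * (S gamma.+1 / S gamma.+2).
Proof. by apply: (lim_series_static (fun x => x * p x)); rewrite mul0r. Qed.

Lemma avg_rate_static :
  avg_rate C mu (static l gamma) = l * (S gamma.+1 / S gamma.+2).
Proof. exact: (lim_series_static id). Qed.

Lemma mean_sojourn_static : mean_sojourn C mu (static l gamma) =
  ((\sum_(i < gamma.+1) t ^+ i * erlang C i * (i.+1%:R / (minn i.+1 C)%:R))
   / S gamma.+1 / mu)%:E.
Proof.
rewrite /mean_sojourn stable_static avg_rate_static /mean_number.
rewrite (eseries_finite_support _ gamma.+2); last first.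
  by move=> i gi; rewrite stationary_static leqNgt gi /= mulr0.
rewrite -EFinM; congr EFin.
rewrite big_ord_recl mul0r add0r.
(* Moving from state [i.+1] back to [i] turns the mean number into a sum over the admitting
   states. *)
have -> : \sum_(i < gamma.+1) (lift ord0 i)%:R
      * stationary C mu (static l gamma) (lift ord0 i) =
    l / mu / S gamma.+2 * \sum_(i < gamma.+1)
      t ^+ i * erlang C i * (i.+1%:R / (minn i.+1 C)%:R).
  rewrite mulr_sumr; apply: eq_bigr => i _.
  rewrite lift0 stationary_static ltn_ord erlangS exprS /t; field.
  by rewrite !gt_eqF ?natr_minn_gt0 ?truncated_sum_gt0// ltr0n.
by field; rewrite !gt_eqF ?truncated_sum_gt0.
Qed.

End Static.
End BirthDeath.

(** * Comparison of a static policy with the critical load *)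

Section StaticComparison.
Context {R : realType}.
Variables (C : nat) (mu l : R) (gamma : nat).
Hypotheses (C0 : (0 < C)%N) (mu0 : 0 < mu) (l0 : 0 < l) (lC : l <= mu * C%:R).
Let t := l / (mu * C%:R).
Let S n := \sum_(i < n) t ^+ i * erlang C i.

Let t01 : 0 <= t <= 1.
Proof.
rewrite ltW ?static_load_gt0//= ler_pdivrMr ?mul1r//.
by rewrite mulr_gt0// ltr0n.
Qed.

Let erlang_ge0 i : 0 <= erlang C i :> R.
Proof. by rewrite ltW// erlang_gt0. Qed.

Lemma sum_erlang_gt0 n : 0 < \sum_(i < n.+1) erlang C i :> R.
Proof.
by rewrite big_ord_recl ltr_pwDl ?erlang_gt0//; apply: sumr_ge0.
Qed.

Lemma static_admission_ge :
  1 - erlang C gamma.+1 / \sum_(i < gamma.+2) erlang C i <= S gamma.+1 / S gamma.+2.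
Proof.
(* Among the states up to [gamma.+1], [h] is the indicator of the blocking state, so its mean is the
   blocking probability, which is largest at the critical load. *)
pose h (i : nat) : R := (gamma < i)%:R.
have hh : {homo h : i j / (i <= j)%N >-> i <= j}.
  move=> i j ij; rewrite /h ler_nat; case: (ltnP gamma i) => // gi.
  by rewrite (leq_trans gi ij).
have := tilted_mean_le t (erlang C) h gamma.+2 t01 erlang_ge0 hh.
have E (u : nat -> R) : \sum_(i < gamma.+2) u i * h i = u gamma.+1.
  rewrite big_ord_recr /= /h ltnSn mulr1 big1 ?add0r// => i _.
  by rewrite ltnNge leq_ord mulr0.
rewrite (E (fun i => t ^+ i * erlang C i)) E.
have S0 : 0 < S gamma.+2 by exact: truncated_sum_gt0.
have -> : S gamma.+1 = S gamma.+2 - t ^+ gamma.+1 * erlang C gamma.+1.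
  by rewrite [in RHS]/S big_ord_recr addrK.
rewrite mulrBl divff ?gt_eqF// lerD2l lerN2 => h1.
rewrite ler_pdivrMr// mulrAC ler_pdivlMr//.
exact: sum_erlang_gt0.
Qed.

Lemma mean_sojourn_static_le : (mean_sojourn C mu (static l gamma) <=
  ((\sum_(i < gamma.+1) erlang C i * (i.+1%:R / (minn i.+1 C)%:R))
   / (\sum_(i < gamma.+1) erlang C i) / mu)%:E)%E.
Proof.
rewrite mean_sojourn_static// lee_fin ler_pM2r ?invr_gt0//.
rewrite ler_pdivrMr ?truncated_sum_gt0// mulrAC ler_pdivlMr ?sum_erlang_gt0//.
exact: (tilted_mean_le t (erlang C) _ gamma.+1 t01 erlang_ge0 (ler_minn_ratio C C0)).
Qed.

End StaticComparison.

(** * Stability and nonnegative revenue of an optimal policy *)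

Section Optimal.
Context {R : realType}.
Variables (C : nat) (mu Lam : R) (p : R -> R) (pol : nat -> R).
Hypotheses (C0 : (0 < C)%N) (mu0 : 0 < mu) (Lam0 : 0 < Lam).
Hypotheses (opt : optimal C mu Lam p pol).

(** With cutoff 0 nobody waits on entering, so the mean sojourn time is [mu^-1]; the system is empty
    with probability [1 / (1 + l / mu)]. *)
Lemma objective_static0 (l : R) : 0 < l ->
  sojourn_objective C mu p (static l 0) = (l * p l / (1 + l / mu) - mu^-1)%:E.
Proof.
move=> l0; rewrite /sojourn_objective revenue_static// mean_sojourn_static//.
have e0 : erlang C 0 = 1 :> R by rewrite /erlang big_ord0.
rewrite -EFinD; congr EFin; rewrite !big_ord_recl !big_ord0 /= /bump /=.
rewrite expr0 expr1 erlangS e0 (minn_idPl C0); field.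
by rewrite !gt_eqF ?addr_gt0 ?mulr_gt0// ltr0n.
Qed.

Lemma static0_le_optimal (l : R) : 0 < l <= Lam ->
  ((l * p l / (1 + l / mu) - mu^-1)%:E <= sojourn_objective C mu p pol)%E.
Proof.
move=> /andP[l0 lL]; rewrite -objective_static0//; apply: (opt.2).
split; last by rewrite /static.
by move=> i; rewrite /static; case: ifP; rewrite ?lexx ?lL ltW.
Qed.

(** An unstable policy has objective [-oo], below the finite value at rate [Lam] and cutoff 0. *)
Lemma optimal_stable : stable C mu pol.
Proof.
apply/negPn/negP => unst.
have := static0_le_optimal Lam; rewrite Lam0 lexx => /(_ isT).
by rewrite /sojourn_objective /mean_sojourn (negbTE unst) addeNy leeNy_eq.
Qed.

Lemma optimal_revenue_ge0 :
  concave_on `[0, Lam] (fun l => l * p l) -> 0 <= revenue C mu p pol.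
Proof.
move=> cg; have [[pol01 p0] _] := opt.
have W := mean_sojourn_ge C mu C0 mu0 pol Lam pol01 optimal_stable p0.
have lower e : 0 < e <= Lam -> - (e / Lam * `|Lam * p Lam|) <= revenue C mu p pol.
  move=> /[dup] /static0_le_optimal + /andP[e0 eL] => h.
  (* The optimal sojourn time is at least [mu^-1] by [W], so that cost cancels. *)
  have {h} : e * p e / (1 + e / mu) <= revenue C mu p pol.
    rewrite -(lerD2r (- mu^-1)) -lee_fin; apply: (le_trans h).
    by rewrite /sojourn_objective EFinB leeB.
  apply: le_trans.
  have D1 : 1 <= 1 + e / mu by rewrite lerDl divr_ge0// ltW.
  have D0 : 0 < 1 + e / mu := lt_le_trans ltr01 D1.
  rewrite ler_pdivlMr// mulNr lerNl.
  have eL0 : 0 <= e / Lam by rewrite divr_ge0// ltW.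
  (* The chord from 0, where [l * p l] vanishes, to [Lam] bounds [e * p e] from below by a multiple
     of [e]. *)
  have := concave_chord Lam _ cg 0 e Lam (lexx _) (ltW e0) eL (lexx _).
  rewrite !subr0 mul0r mulr0 add0r => ch.
  have {ch} : e / Lam * (Lam * p Lam) <= e * p e.
    by rewrite mulrAC ler_pdivrMr// [leRHS]mulrC.
  rewrite -lerN2 => /le_trans; apply.
  rewrite -mulrN; apply: (@le_trans _ _ (e / Lam * `|Lam * p Lam|)).
    by rewrite ler_wpM2l// -normrN ler_norm.
  by rewrite ler_peMr// mulr_ge0.
rewrite leNgt; apply/negP => r0.
set r := revenue C mu p pol in lower r0 *; set M := `|Lam * p Lam| in lower.
have M0 : 0 <= M by exact: normr_ge0.
(* [e] is chosen so that [e / Lam * M < - r]. *)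
pose d := - r / (M + 1 - r).
have D0 : 0 < M + 1 - r by lra.
have d0 : 0 < d by rewrite divr_gt0// oppr_gt0.
have d1 : d <= 1 by rewrite ler_pdivrMr// mul1r; lra.
have := lower (d * Lam).
rewrite mulr_gt0//= ler_piMl ?(ltW Lam0)// => /(_ isT).
rewrite mulfK ?gt_eqF// => h.
have dE : d * (M + 1 - r) = - r by rewrite divfK// gt_eqF.
nra.
Qed.

End Optimal.

Theorem theorem5 (R : realType) (C : nat) (Lam mu : R)
    (F : cumulativeBounded (0 : R) (1 : R)) (prices : set R) (p : R -> R)
    (pistar : policy) (gamma : nat) :
  (1 <= C)%N -> 0 < Lam -> 0 < mu ->
  regular F ->
  inverse_demand Lam F prices p ->
  concave_on `[0, Lam] (fun l => l * p l) ->
  optimal C mu Lam p pistar ->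
  (C - 1 <= gamma)%N ->
  let pitilde := static (avg_rate C mu pistar) gamma in
  revenue C mu p pitilde >=
    (1 - (C%:R ^+ C / C`!%:R) /
         (\sum_(0 <= l < C.+1) C%:R ^+ l / l`!%:R
          + C%:R ^+ C / C`!%:R * (gamma%:R + 1 - C%:R)))
    * revenue C mu p pistar
  /\
  (mean_sojourn C mu pitilde <=
    ((\sum_(1 <= i < C.+1) C%:R ^+ i / (i.-1)`!%:R
      + C%:R ^+ C / C`!%:R * \sum_(C.+1 <= i < gamma.+2) i%:R) /
     (\sum_(0 <= l < C.+1) C%:R ^+ l.+1 / l`!%:R
      + (gamma%:R - C%:R) / C`!%:R * C%:R ^+ C.+1))%:E
    * mean_sojourn C mu pistar)%E.
Proof.
move=> C1 Lam0 mu0 _ _ cg opt Cg pitilde.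
have [[pol01 p0] _] := opt.
have stab := optimal_stable C mu Lam p pistar C1 mu0 Lam0 opt.
pose a := avg_rate C mu pistar.
have a0 : 0 < a := avg_rate_gt0 C mu C1 mu0 pistar Lam pol01 stab p0.
have aC : a <= mu * C%:R := avg_rate_le_capacity C mu C1 mu0 pistar Lam pol01 stab.
have R0 := optimal_revenue_ge0 C mu Lam p pistar C1 mu0 Lam0 opt cg.
have C0 : 0 < C%:R :> R by rewrite ltr0n.
split.
  rewrite /pitilde revenue_static// -/a.
  have := static_admission_ge C mu a gamma C1 mu0 a0 aC.
  (* As [C <= gamma.+1], the weight of the blocking state is [C ^ C / C!]. *)
  rewrite sum_erlang// ?erlang_ge//; last 2 first.
  - by rewrite -add1n -leq_subLR.
  - by rewrite -add1n -leq_subLR.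
  rewrite -natr1 => adm.
  have RJ : revenue C mu p pistar <= a * p a.
    exact: (jensen_series Lam _ Lam0 cg _ _ a
      (stationary_ge0 C mu C1 mu0 pistar Lam pol01 stab) pol01
      (cvg_series_stationary C mu C1 mu0 pistar Lam pol01 stab)
      (cvg_avg_rate C mu C1 mu0 pistar Lam pol01 stab) a0).
  (* The admission bound is multiplied by the optimal revenue, whence the need for its sign [R0]. *)
  apply: (le_trans (ler_wpM2r R0 adm)).
  by rewrite [leRHS]mulrC ler_wpM2l// divr_ge0// ltW// truncated_sum_gt0//.
apply: (le_trans (mean_sojourn_static_le C mu a gamma C1 mu0 a0 aC)).
(* Numerator and denominator of the constant each carry a factor [C], which cancels; the remaining
   [mu^-1] is bounded by the optimal sojourn time. *)
rewrite -sum_erlang_pred// -sum_erlang_weighted//.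
rewrite -mulf_div divff ?gt_eqF// mul1r [leLHS]EFinM lee_wpmul2l//.
  rewrite lee_fin divr_ge0//.
    by apply: sumr_ge0 => i _; rewrite mulr_ge0 ?divr_ge0// ltW// erlang_gt0.
  by rewrite ltW// sum_erlang_gt0.
exact: mean_sojourn_ge C mu C1 mu0 pistar Lam pol01 stab p0.
Qed.
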